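(* Let $0<\mu\le1$, let $f=\mathbf{1}_{(0,\infty)}$, and put $p_\mu=\nu_\mu((0,\infty))$ and $f_k=\langle f,r_k^{(\mu)}\rangle_{L^2(\nu_\mu)}$ for $k\in\mathbb{N}_0$. Then $f_0=p_\mu$ and, for every $k\ge1$, $$f_k=\frac{w_1(0)}{\lambda_k(\mu)}\left[e_0^{(\mu)}(0)\,(e_k^{(\mu)})'(0)-(e_0^{(\mu)})'(0)\,e_k^{(\mu)}(0)\right].$$
   Context: $w_1(x)=(2\pi)^{-1/2}e^{-x^2/2}$ and $\gamma(\mathrm{d}x)=w_1(x)\,\mathrm{d}x$ on $\mathbb{R}$; $W^{1,2}(\gamma)$ is the space of locally absolutely continuous $f$ with $f,f'\in L^2(\gamma)$; $\mathbb{N}_0=\{0,1,2,\dots\}$. For $0<\mu\le1$ let $c_\mu=\frac{1-\mu^2}{4\mu^2}$ and let $A_\mu$ be the nonnegative self-adjoint operator in $L^2(\gamma)$ associated with the closed form $$a_\mu[f,g]=\int_{-\infty}^\infty f'\overline{g'}\,\mathrm{d}\gamma+c_\mu\int_{-\infty}^0x^2f\overline g\,\mathrm{d}\gamma,\qquad \mathrm{Dom}(a_\mu)=W^{1,2}(\gamma);$$ it acts as $A_\mu f=-f''+xf'+c_\mu x^2\mathbf{1}_{\{x<0\}}f$. It has compact resolvent, simple eigenvalues $0\le\alpha_0(\mu)<\alpha_1(\mu)<\cdots\to\infty$, and a real-valued orthonormal basis $(e_k^{(\mu)})_{k\ge0}$ of $L^2(\gamma)$ of continuously differentiable eigenfunctions,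 $A_\mu e_k^{(\mu)}=\alpha_k(\mu)e_k^{(\mu)}$, with $e_0^{(\mu)}>0$ everywhere. Set $\nu_\mu(\mathrm{d}x)=(e_0^{(\mu)}(x))^2\gamma(\mathrm{d}x)$ (a probability measure), $r_k^{(\mu)}=e_k^{(\mu)}/e_0^{(\mu)}$ (an orthonormal basis of $L^2(\nu_\mu)$ with $r_0^{(\mu)}=1$), and $\lambda_k(\mu)=\alpha_k(\mu)-\alpha_0(\mu)$. *)

(* Defs.v *)
From HB Require Import structures.
From mathcomp Require Import all_boot all_order all_algebra.
From mathcomp Require Import complex.
From mathcomp Require Import all_classical all_reals all_analysis.
From mathcomp Require Import measurable_realfun.

Set Implicit Arguments.
Unset Strict Implicit.
Unset Printing Implicit Defensive.

Import Order.TTheory GRing.Theory Num.Theory.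
Import numFieldNormedType.Exports.

Local Open Scope classical_set_scope.
Local Open Scope ring_scope.
Local Open Scope complex_scope.

Section Gaussian.
Variable R : realType.

Definition w1 (x : R) : R := (Num.sqrt (2 * pi))^-1 * expR (- x ^+ 2 / 2).

Definition gamma : probability (measurableTypeR R) R := normal_prob (0 : R) 1.

Lemma normal_pdf01E : normal_pdf (0 : R) 1 = w1.
Proof.
rewrite normal_pdfE ?oner_neq0//; apply/funext => x.
by rewrite /normal_peak /normal_fun /w1 subr0 !expr1n mul1r mulr_natl.
Qed.

Lemma gammaE (A : set R) :
  gamma A = (\int[lebesgue_measure]_(x in A) (w1 x)%:E)%E.
Proof. by rewrite -normal_pdf01E. Qed.

End Gaussian.

Arguments gamma {R}.

Section ComplexFunctions.
Variable R : realType.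
Implicit Types (f g : R -> R[i]) (D : set R).

Definition cfun_of (u : R -> R) : R -> R[i] := fun x => (u x)%:C.

Definition cintegral (mu : {measure set (measurableTypeR R) -> \bar R}) D f : R[i] :=
  (\int[mu]_(x in D) complex.Re (f x)) +i* (\int[mu]_(x in D) complex.Im (f x)).

Definition inner (mu : {measure set (measurableTypeR R) -> \bar R}) f g : R[i] :=
  cintegral mu setT (fun x => f x * conjc (g x)).

Definition L2 f : Prop :=
  (@complex.Re R \o f \in Lfun (@gamma R) 2%:E) /\
  (@complex.Im R \o f \in Lfun (@gamma R) 2%:E).

(* The `]s i, t i[ are pairwise disjoint open subintervals of `[a, b]. *)
Definition abs_continuous_on (a b : R) (u : R -> R) : Prop :=
  forall eps : R, 0 < eps -> exists2 delta : R, 0 < delta &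
    forall (n : nat) (s t : 'I_n -> R),
      (forall i, [/\ a <= s i, s i <= t i & t i <= b]) ->
      (forall i j, i != j -> t i <= s j \/ t j <= s i) ->
      \sum_(i < n) (t i - s i) < delta ->
      \sum_(i < n) `|u (t i) - u (s i)| < eps.

Definition locally_abs_continuous (u : R -> R) : Prop :=
  forall a b : R, a <= b -> abs_continuous_on a b u.

(* For a locally absolutely continuous f this is the a.e. derivative; on the
   null set where f is not differentiable its value is immaterial. *)
Definition cderive f : R -> R[i] :=
  fun x => derive1 (@complex.Re R \o f) x +i* derive1 (@complex.Im R \o f) x.

Definition W12 f : Prop :=
  [/\ locally_abs_continuous (@complex.Re R \o f),
      locally_abs_continuous (@complex.Im R \o f), L2 f & L2 (cderive f)].

End ComplexFunctions.

Section Operator.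
Variable R : realType.
Implicit Types (mu : R) (f g h : R -> R[i]).

Definition cpot mu : R := (1 - mu ^+ 2) / (4 * mu ^+ 2).

Definition form_a mu f g : R[i] :=
  inner gamma (cderive f) (cderive g) +
  (cpot mu)%:C *
    cintegral gamma `]-oo, 0] (fun x => (x ^+ 2)%:C * f x * conjc (g x)).

(* The graph of the self-adjoint operator associated with the closed form
   form_a: f is in its domain with image h iff f is in the form domain and
   h in L^2(gamma) represents form_a mu f. *)
Definition op_A mu f h : Prop :=
  [/\ W12 f, L2 h & forall g, W12 g -> form_a mu f g = inner gamma h g].

Definition orthonormal_basis (e : nat -> R -> R[i]) : Prop :=
  [/\ forall k, L2 (e k),
      forall j k, inner gamma (e j) (e k) = (j == k)%:R
    & forall f, L2 f ->
      (\int[gamma]_x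
         (Normc.normc (f x - \sum_(k < n) inner gamma f (e k) * e k x) ^+ 2)%:E)%E
        @[n --> \oo] --> 0%E].

Record eigensystem mu (alpha : nat -> R) (e : nat -> R -> R) : Prop :=
  Eigensystem {
    alpha_ge0 : 0 <= alpha 0%N;
    alpha_increasing : forall k, alpha k < alpha k.+1;
    alpha_cvg : alpha k @[k --> \oo] --> +oo;
    eigen_derivable : forall k x, derivable (e k) x 1;
    eigen_derive_continuous : forall k, continuous (derive1 (e k));
    eigen_eq : forall k,
      op_A mu (cfun_of (e k)) (cfun_of (fun x => alpha k * e k x));
    eigen_basis : orthonormal_basis (fun k => cfun_of (e k));
    ground_state_gt0 : forall x, 0 < e 0%N x
  }.

Definition rquot (e : nat -> R -> R) (k : nat) : R -> R :=
  fun x => e k x / e 0%N x.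

Definition gap (alpha : nat -> R) (k : nat) : R := alpha k - alpha 0%N.

End Operator.

Definition nu (R : realType) (mu : R) (alpha : nat -> R) (e : nat -> R -> R)
    (he : eigensystem mu alpha e) : set (measurableTypeR R) -> \bar R :=
  fun A => (\int[gamma]_(x in A) (e 0%N x ^+ 2)%:E)%E.

Section NuProbability.
Context (R : realType) (mu : R) (alpha : nat -> R) (e : nat -> R -> R).
Variable he : eigensystem mu alpha e.

Let nu0 : nu he set0 = 0%E. Proof. by rewrite /nu integral_set0. Qed.

Let nu_ge0 A : (0 <= nu he A)%E.
Proof. by apply: integral_ge0 => x _; rewrite lee_fin sqr_ge0. Qed.

Let nu_sigma_additive : semi_sigma_additive (nu he).
Proof.
apply: semi_sigma_additive_nng_induced; last first.
  by move=> x; rewrite lee_fin sqr_ge0.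
apply/measurable_EFinP; apply: measurable_funX.
apply: continuous_measurable_fun => x.
exact/differentiable_continuous/derivable1_diffP/(eigen_derivable he).
Qed.

HB.instance Definition _ := isMeasure.Build _ _ _
  (nu he) nu0 nu_ge0 nu_sigma_additive.

Let nu_setT : nu he setT = 1%E.
Proof.
have [_ /(_ 0%N 0%N) + _] := eigen_basis he.
rewrite eqxx /inner /cintegral => -[]; rewrite /Rintegral /=.
under eq_integral do rewrite oppr0 mulr0 subr0 -expr2.
by rewrite -/(nu he setT); case: (nu he setT) => //= [r -> //| |] /esym/eqP;
  rewrite oner_eq0.
Qed.

HB.instance Definition _ := @Measure_isProbability.Build _ _ _
  (nu he) nu_setT.

End NuProbability.

(* Main.v *)
Require Import Defs.
From mathcomp Require Import all_boot all_order all_algebra.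
From mathcomp Require Import complex.
From mathcomp Require Import all_classical all_reals all_analysis.
From mathcomp Require Import measurable_realfun.
From mathcomp Require Import ring lra.

(** Multiplying an eigenfunction by a bounded C^1 function phi with bounded
derivative gives an element of the form domain, whereas e_0 times the indicator
of the half line jumps at 0 and is no admissible test function. Testing the equation of e_k against
e_0 phi and the equation of e_0 against e_k phi, and subtracting, cancels both
the symmetric gradient part e_k' e_0' phi and the whole potential term. What
remains is a Green identity without boundary terms ([green_identity]),

   int phi' (e_0 e_k' - e_0' e_k) dgamma
     = (alpha_k - alpha_0) int e_k e_0 phi dgamma.

Take phi_n (x) = ramp (n.+1 x), where ramp is a C^1 step from 0 to 1 on [0, 1].
The derivatives phi_n' form an approximate identity at 0+, so the left-hand side
tends to the Wronskian at 0 times w1 0, by continuity ([cvg_Rintegral_shat]).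
On the right phi_n tends to the indicator of the open half line and dominated
convergence applies. The limit is [gap_half_line_integral]. Finally the weight
e_0^2 of nu turns the coefficient of the indicator along e_k / e_0 into
int_(0, oo) e_k e_0 dgamma ([inner_nu_rquot]), and the gap is nonzero because
the eigenvalues increase strictly. *)

Set Implicit Arguments.
Unset Strict Implicit.
Unset Printing Implicit Defensive.

Import Order.TTheory GRing.Theory Num.Theory.
Import numFieldNormedType.Exports.

Local Open Scope classical_set_scope.
Local Open Scope ring_scope.
Local Open Scope complex_scope.

(** * Integration against a measure given by a density *)

Section Density.
Local Open Scope ereal_scope.
Context d (T : measurableType d) (R : realType).
Variables (P : {finite_measure set T -> \bar R})
          (m : {sigma_finite_measure set T -> \bar R}) (h : T -> R).
Hypotheses (mh : measurable_fun setT h) (h_ge0 : forall x, (0 <= h x)%R).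
Hypothesis PE : forall A, measurable A -> P A = \int[m]_(x in A) (h x)%:E.

Lemma density_dominated : P `<< m.
Proof.
apply/null_content_dominatesP => A mA mA0; rewrite PE//.
by apply: null_set_integral => //; apply/measurable_funTS/measurable_EFinP.
Qed.

(** The density h is almost everywhere the Radon-Nikodym derivative, for which
the nonnegative change of variables is known. *)
Lemma ge0_integral_density (f : T -> \bar R) (E : set T) : measurable E ->
  measurable_fun E f -> (forall x, 0 <= f x) ->
  \int[P]_(x in E) f x = \int[m]_(x in E) (f x * (h x)%:E).
Proof.
move=> mE mf f0.
have Pm := density_dominated.
have [mg ig] := (Radon_Nikodym_SigmaFinite.f_integrable Pm,
                 Radon_Nikodym_SigmaFinite.f_integral Pm).
rewrite -(Radon_Nikodym_SigmaFinite.change_of_variables Pm)//.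
apply: ae_eq_integral => //.
- apply: emeasurable_funM => //.
  by apply: measurable_funTS; exact: measurable_int mg.
- by apply: emeasurable_funM => //; apply/measurable_funTS/measurable_EFinP.
- apply: ae_eqe_mul2l; apply: integral_ae_eq => //.
  + exact: integrableS mg.
  + exact/measurable_funTS/measurable_EFinP.
  + by move=> A AE mA; rewrite -PE// -ig.
Qed.

(** Multiplication by h >= 0 commutes with taking positive and negative parts,
so the signed case reduces to the nonnegative one term by term. *)
Lemma integral_density (f : T -> \bar R) (E : set T) : measurable E ->
  measurable_fun E f ->
  \int[P]_(x in E) f x = \int[m]_(x in E) (f x * (h x)%:E).
Proof.
move=> mE mf; rewrite integralE [RHS]integralE.
rewrite !ge0_integral_density//; last 2 first.
- exact: measurable_funeneg.
- exact: measurable_funepos.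
congr (_ - _); apply: eq_integral => x _.
- rewrite !funeposE/= maxe_pMl ?mul0e//; last by rewrite lee_fin.
- rewrite !funenegE/= -mulNe maxe_pMl ?mul0e// lee_fin//.
Qed.

Lemma Rintegral_density (f : T -> R) (E : set T) : measurable E ->
  measurable_fun E f ->
  (\int[P]_(x in E) f x = \int[m]_(x in E) (f x * h x))%R.
Proof.
by move=> mE mf; congr fine; rewrite integral_density//; exact/measurable_EFinP.
Qed.

End Density.

(** * A continuously differentiable ramp *)

Section Ramp.
Variable R : realType.
Implicit Types x y : R.

Lemma is_derive_quadratic_bound (f : R -> R) x a C :
  (forall y, `|f y - f x - a * (y - x)| <= C * (y - x) ^+ 2) ->
  is_derive x 1 f a.
Proof.
move=> fC; apply/is_derive1_caratheodory.
pose g z := if z == x then a else (f z - f x) / (z - x).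
have gC z : `|g z - a| <= C * `|z - x|.
  rewrite /g; have [->|zx] := eqVneq; first by rewrite !subrr normr0 mulr0.
  have zx0 : 0 < `|z - x| by rewrite normr_gt0 subr_eq0.
  rewrite -(ler_pM2r zx0) -mulrA -expr2 real_normK ?num_real//.
  by rewrite -normrM mulrBl divfK ?subr_eq0.
exists g; split; last by rewrite /g eqxx.
  move=> z; rewrite /g; have [->|zx] := eqVneq; first by rewrite !subrr mulr0.
  by rewrite divfK ?subr_eq0.
rewrite /prop_for /continuous_at {2}/g eqxx.
apply/cvgrPdist_le => /= eps eps0; near=> z.
rewrite distrC (le_trans (gC z))//.
have C0 : 0 <= `|C| + 1 by [].
have : `|z - x| <= eps / (`|C| + 1).
  near: z; apply: (@cvgr_distC_le _ _ _ _ _ id x); first exact: cvg_id.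
  by rewrite divr_gt0// ltr_wpDl.
rewrite ler_pdivlMr ?ltr_wpDl// mulrC; apply: le_trans.
by rewrite ler_wpM2r// (le_trans (ler_norm C))// lerDl.
Unshelve. all: by end_near. Qed.

(** The piecewise quadratic step: its second derivative is 4 on (0, 1/2), -4 on
(1/2, 1) and 0 elsewhere. Writing it with squared positive parts makes it C^1
without any gluing of derivatives at the knots 0, 1/2 and 1. *)
Definition ramp x : R :=
  2 * (Num.max 0 x ^+ 2 - 2 * Num.max 0 (x - 2^-1) ^+ 2 +
       Num.max 0 (x - 1) ^+ 2).

Definition hat x : R :=
  4 * (Num.max 0 x - 2 * Num.max 0 (x - 2^-1) + Num.max 0 (x - 1)).

(** The squared positive part y |-> max(0, y)^2 differs from its tangent at z by
at most (y - z)^2, whatever the signs of y and z. The constant 8 below adds up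
the absolute values of the coefficients 2, -4 and 2 of the three translates. *)
Lemma is_derive_ramp x : is_derive x 1 ramp (hat x).
Proof.
have sq_max (c : R) y : `|Num.max 0 (y - c) ^+ 2 - Num.max 0 (x - c) ^+ 2 -
    2 * Num.max 0 (x - c) * (y - x)| <= (y - x) ^+ 2.
  rewrite (_ : y - x = (y - c) - (x - c)); last by ring.
  move: (y - c) (x - c) => {}y z; have := sqr_ge0 (y - z); rewrite ler_norml.
  by case: (ltP 0 y) => y0; case: (ltP 0 z) => z0 yz; apply/andP; split; nra.
apply: (@is_derive_quadratic_bound _ _ _ 8) => y.
have := sq_max 0 y; have := sq_max 2^-1 y; have := sq_max 1 y.
rewrite !subr0 /ramp /hat !ler_norml => /andP[? ?] /andP[? ?] /andP[? ?].
by apply/andP; split; lra.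
Qed.

Lemma ramp_itv x : 0 <= ramp x <= 1.
Proof.
rewrite /ramp; case: (ltP 0 x) => ?; case: (ltP 0 (x - 2^-1)) => ?;
  case: (ltP 0 (x - 1)) => ?; nra.
Qed.

Lemma ramp_le0 x : x <= 0 -> ramp x = 0.
Proof.
move=> ?; rewrite /ramp !max_l; [by ring|lra..].
Qed.

Lemma ramp_ge1 x : 1 <= x -> ramp x = 1.
Proof.
move=> ?; rewrite /ramp !max_r; [by field|lra..].
Qed.

Lemma hat_itv x : 0 <= hat x <= 2.
Proof.
rewrite /hat; case: (ltP 0 x) => ?; case: (ltP 0 (x - 2^-1)) => ?;
  case: (ltP 0 (x - 1)) => ?; lra.
Qed.

Lemma hat_out x : x \notin `[0, 1]%R -> hat x = 0.
Proof.
rewrite in_itv/= negb_and -!ltNge /hat => /orP[/ltW ?|/ltW ?].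
  rewrite !max_l; [by ring|lra..].
rewrite !max_r; [by field|lra..].
Qed.

Lemma continuous_hat : continuous hat.
Proof.
have cmax (c : R) : continuous (fun x => Num.max 0 (x - c)).
  move=> x; apply: (@continuous_max _ _ (cst 0) (fun x => x - c)).
    exact: cvg_cst.
  by apply: cvgB; [exact: cvg_id|exact: cvg_cst].
rewrite /hat => x; apply: cvgM; first exact: cvg_cst.
apply: cvgD; last exact: cmax.
apply: cvgB; first by have := @cmax 0 x; under eq_fun do rewrite subr0.
by apply: cvgM; [exact: cvg_cst|exact: cmax].
Qed.

End Ramp.

(** * Square-integrable functions and the form domain *)

Section Lfun_facts.
Context d (T : measurableType d) (R : realType).
Variable m : {measure set T -> \bar R}.

Lemma Lfun_measurable (p : \bar R) (f : T -> R) :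
  f \in Lfun m p -> measurable_fun setT f.
Proof. by rewrite inE => /andP[/[!inE]]. Qed.

Lemma Lfun2_dominated (f g : T -> R) : f \in Lfun m 2%:E ->
  measurable_fun setT g -> (forall x, `|g x| <= `|f x|) -> g \in Lfun m 2%:E.
Proof.
move=> f2 mg gf; rewrite inE; apply/andP; split; rewrite inE//=.
have mn (h : T -> R) : measurable_fun setT h ->
    measurable_fun setT (fun x => (`|h x| `^ 2)%:E).
  move=> mh; apply/measurable_EFinP.
  apply: (@measurableT_comp _ _ _ _ _ _ (@powR R ^~ 2)) => //.
  exact: measurableT_comp.
rewrite /finite_norm unlock /Lnorm poweR_lty//.
have /integrableP[_] := Lfun_integrable (ler1n R 2) f2.
apply: le_lt_trans.
apply: ge0_le_integral => //=.
- exact: mn.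
- apply/measurable_EFinP/measurableT_comp => //.
  exact/measurable_EFinP/mn/(Lfun_measurable f2).
- move=> x _; rewrite lee_fin [leRHS]ger0_norm ?powR_ge0//.
  by rewrite ge0_ler_powR// ?nnegrE.
Qed.

Lemma Lfun2_mul_bounded (f g : T -> R) C : f \in Lfun m 2%:E ->
  measurable_fun setT g -> (forall x, `|g x| <= C) ->
  (fun x => f x * g x) \in Lfun m 2%:E.
Proof.
move=> f2 mg gC.
apply: (Lfun2_dominated (Lfun_scale C (ler1n R 2) f2)).
- by apply: measurable_funM => //; exact: Lfun_measurable f2.
- move=> x; rewrite /= !normrM ler_wpM2l//.
  exact: le_trans (gC x) (ler_norm C).
Qed.

Lemma Lfun2_mul_integrable (f g : T -> R) : f \in Lfun m 2%:E ->
  g \in Lfun m 2%:E -> m.-integrable setT (fun x => (f x * g x)%:E).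
Proof. by move=> f2 g2; exact/Lfun1_integrable/Lfun2_mul_Lfun1. Qed.

End Lfun_facts.

Section Calculus.
Variable R : realType.

(** On a segment the derivative is bounded, so the mean value theorem makes u
Lipschitz there. *)
Lemma C1_locally_abs_continuous (u du : R -> R) :
  (forall x : R, is_derive x 1 u (du x)) -> continuous du ->
  locally_abs_continuous u.
Proof.
move=> u' cdu a b ab eps eps0.
have [c _ cmax] : exists2 c, c \in `[a, b]%R &
    forall t, t \in `[a, b]%R -> `|du t| <= `|du c|.
  apply: (@EVT_max _ (fun t => `|du t|)) => //.
  apply: continuous_subspaceT => x.
  by apply: cvg_norm; exact: cdu.
set M := `|du c| in cmax; have M1 : 0 < M + 1 by rewrite ltr_wpDl ?normr_ge0.
(* The extra 1 keeps delta positive when u is constant. *)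
exists (eps / (M + 1)) => [|n s t st _]; first by rewrite divr_gt0.
rewrite ltr_pdivlMr// mulr_suml; apply: le_lt_trans.
apply: ler_sum => i _; have [as_ sti tb] := st i.
have [|z zst ->] := MVT_segment sti (fun x _ => u' x).
  apply: continuous_subspaceT => x.
  by apply/differentiable_continuous/derivable1_diffP; case: (u' x).
rewrite normrM (ger0_norm (_ : 0 <= t i - s i)) ?subr_ge0// mulrC.
rewrite ler_wpM2l ?subr_ge0// (le_trans (cmax z _))//; last by rewrite lerDl.
move: zst; rewrite !in_itv/= => /andP[sz zt].
by rewrite (le_trans as_ sz) (le_trans zt tb).
Qed.

Lemma is_derive_derive1 (u : R -> R) (du x : R) :
  is_derive x 1 u du -> derive1 u x = du.
Proof. by move=> [_ <-]; rewrite derive1E. Qed.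

Lemma is_derive_mul (u v : R -> R) (du dv x : R) :
  is_derive x 1 u du -> is_derive x 1 v dv ->
  is_derive x 1 (fun y => u y * v y) (du * v x + u x * dv).
Proof.
move=> u' v'; apply: (is_derive_eq (is_deriveM u' v')).
by rewrite addrC /GRing.scale/= mulrC.
Qed.

Lemma is_derive_continuous (u du : R -> R) :
  (forall x : R, is_derive x 1 u (du x)) -> continuous u.
Proof.
by move=> u' x; apply/differentiable_continuous/derivable1_diffP; case: (u' x).
Qed.

End Calculus.

Section Test.
Variable R : realType.
Implicit Types u du v dv : R -> R.

Lemma L2_cfun_of u : u \in Lfun (@gamma R) 2%:E -> L2 (cfun_of u).
Proof. by move=> u2; split => //; exact: (@Lfun_cst _ _ _ (@gamma R) 0 2). Qed.

Lemma cderive_cfun_of u : cderive (cfun_of u) = cfun_of (derive1 u).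
Proof.
apply/funext => x; rewrite /cfun_of -[RHS]/(derive1 u x +i* 0).
by rewrite -(derive1_cst (0 : R) x).
Qed.

Lemma W12_C1 u du : (forall x : R, is_derive x 1 u (du x)) -> continuous du ->
  u \in Lfun (@gamma R) 2%:E -> du \in Lfun (@gamma R) 2%:E ->
  W12 (cfun_of u).
Proof.
move=> u' cdu u2 du2; split.
- exact: C1_locally_abs_continuous cdu.
- apply: (@C1_locally_abs_continuous _ (cst 0) (cst 0)) => // x.
  exact: cst_continuous.
- exact: L2_cfun_of.
- rewrite cderive_cfun_of (_ : derive1 u = du); first exact: L2_cfun_of.
  by apply/funext => x; exact: is_derive_derive1.
Qed.

Lemma Re_inner_cfun_of (m : {measure set (measurableTypeR R) -> \bar R}) u v :
  complex.Re (inner m (cfun_of u) (cfun_of v)) = \int[m]_x (u x * v x).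
Proof.
by rewrite /inner /cintegral/=; apply: eq_Rintegral => x _; rewrite mul0r subr0.
Qed.

Lemma inner_cfun_of (m : {measure set (measurableTypeR R) -> \bar R}) u v :
  inner m (cfun_of u) (cfun_of v) = (\int[m]_x (u x * v x))%:C.
Proof.
apply/eqP; rewrite eq_complex Re_inner_cfun_of eqxx /inner /cintegral/=.
apply/eqP; rewrite (@eq_Rintegral _ _ _ _ _ (cst 0)) ?Rintegral_cst ?mul0r//.
by move=> x _ /=; rewrite mul0r oppr0 mulr0 addr0.
Qed.

Lemma Re_form_cfun_of mu u v :
  complex.Re (form_a mu (cfun_of u) (cfun_of v)) =
  \int[gamma]_x (derive1 u x * derive1 v x) +
  cpot mu * \int[gamma]_(x in `]-oo, 0]) (x ^+ 2 * u x * v x).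
Proof.
rewrite /form_a !cderive_cfun_of inner_cfun_of/=; congr (_ + _).
rewrite [X in _ - X]mul0r subr0; congr (_ * _).
by apply: eq_Rintegral => x _ /=; ring.
Qed.
End Test.

(** * The Green identity for a smooth cutoff *)

Section Eigenfunctions.
Variables (R : realType) (mu : R) (alpha : nat -> R) (e : nat -> R -> R).
Hypothesis he : eigensystem mu alpha e.
Implicit Types j k : nat.

Lemma is_derive_eigen k (x : R) : is_derive x 1 (e k) (derive1 (e k) x).
Proof. by rewrite derive1E; exact/derivableP/(eigen_derivable he). Qed.

Lemma eigen_continuous k : continuous (e k).
Proof. exact: is_derive_continuous (is_derive_eigen k). Qed.

Lemma eigen_Lfun2 k : e k \in Lfun (@gamma R) 2%:E.
Proof. by have [[_ _ [+ _] _] _ _] := eigen_eq he k. Qed.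

Lemma derive_eigen_Lfun2 k : derive1 (e k) \in Lfun (@gamma R) 2%:E.
Proof.
by have [[_ _ _ +] _ _] := eigen_eq he k; rewrite cderive_cfun_of => -[].
Qed.

Variables (phi dphi : R -> R) (B : R).
Hypotheses (phi' : forall x : R, is_derive x 1 phi (dphi x))
  (cdphi : continuous dphi)
  (phiB : forall x, `|phi x| <= B) (dphiB : forall x, `|dphi x| <= B).

Let cphi : continuous phi := is_derive_continuous phi'.

Let dtest k (x : R) : R := derive1 (e k) x * phi x + e k x * dphi x.

Let is_derive_test k (x : R) :
  is_derive x 1 (fun y => e k y * phi y) (dtest k x).
Proof. exact: is_derive_mul (is_derive_eigen k x) (phi' x). Qed.

Lemma test_Lfun2 k : (fun x => e k x * phi x) \in Lfun (@gamma R) 2%:E.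
Proof.
exact: (Lfun2_mul_bounded (eigen_Lfun2 k)
  (continuous_measurable_fun cphi) phiB).
Qed.

Let dtest_Lfun2 k : dtest k \in Lfun (@gamma R) 2%:E.
Proof.
have h1 := Lfun2_mul_bounded (derive_eigen_Lfun2 k)
  (continuous_measurable_fun cphi) phiB.
have h2 := Lfun2_mul_bounded (eigen_Lfun2 k)
  (continuous_measurable_fun cdphi) dphiB.
exact: (Lfun_addr_closed (@gamma R) (lee1n 2)).2 h1 h2.
Qed.

Lemma weak_eigen_eq j k :
  \int[gamma]_x (derive1 (e k) x * dtest j x) +
    cpot mu * \int[gamma]_(x in `]-oo, 0]) (x ^+ 2 * e k x * (e j x * phi x)) =
  alpha k * \int[gamma]_x (e k x * e j x * phi x).
Proof.
have [_ _ /(_ (cfun_of (fun x => e j x * phi x)))] := eigen_eq he k.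
have cdtest : continuous (dtest j).
  move=> x; apply: cvgD; apply: cvgM.
  - exact: (eigen_derive_continuous he).
  - exact: cphi.
  - exact: eigen_continuous.
  - exact: cdphi.
move=> /(_ (W12_C1 (is_derive_test j) cdtest (test_Lfun2 j) (dtest_Lfun2 j))).
move=> /(congr1 (@complex.Re R)); rewrite Re_form_cfun_of Re_inner_cfun_of.
under eq_Rintegral do rewrite (is_derive_derive1 (is_derive_test j _)).
move=> ->; rewrite -RintegralZl//.
  by apply: eq_Rintegral => x _; rewrite !mulrA.
under eq_fun do rewrite /= -mulrA.
exact: Lfun2_mul_integrable (eigen_Lfun2 k) (test_Lfun2 j).
Qed.

Definition wronskian j k (x : R) : R :=
  e j x * derive1 (e k) x - derive1 (e j) x * e k x.

(** The potential terms of the two weak equations are the same integral, and so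
are the parts e_j' e_k' phi of the gradient terms: only the terms in which the
derivative falls on phi survive the subtraction. *)
Lemma green_identity j k :
  \int[gamma]_x (dphi x * wronskian j k x) =
  (alpha k - alpha j) * \int[gamma]_x (e k x * e j x * phi x).
Proof.
have ek := weak_eigen_eq j k; have ej := weak_eigen_eq k j.
rewrite [X in _ = _ * X](_ : _ = \int[gamma]_x (e k x * e j x * phi x)) in ej;
  last first.
  by apply: eq_Rintegral => x _; rewrite (mulrC (e j x)).
rewrite [X in _ * X](_ : _ = \int[gamma]_(x in `]-oo, 0])
    (x ^+ 2 * e k x * (e j x * phi x))) in ej; last first.
  by apply: eq_Rintegral => x _; ring.
rewrite mulrBl -ek -ej opprD addrACA subrr addr0 -RintegralB//.
- by apply: eq_Rintegral => x _; rewrite /wronskian /dtest; ring.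
- exact: Lfun2_mul_integrable (derive_eigen_Lfun2 k) (dtest_Lfun2 j).
- exact: Lfun2_mul_integrable (derive_eigen_Lfun2 j) (dtest_Lfun2 k).
Qed.

End Eigenfunctions.

(** * Ramps shrinking to the indicator of the half line *)

Section ShrinkingRamp.
Variable R : realType.
Notation leb := (@lebesgue_measure R).
Implicit Types (n : nat) (x : R).

Definition sramp n x : R := ramp (n.+1%:R * x).
Definition shat n x : R := hat (n.+1%:R * x) * n.+1%:R.

Lemma is_derive_sramp n x : is_derive x 1 (sramp n) (shat n x).
Proof.
have lin : is_derive x 1 (fun y : R => n.+1%:R * y) n.+1%:R.
  have := is_deriveZ (n.+1%:R : R) (is_derive_id x (1 : R)).
  by move/is_derive_eq; apply; rewrite /GRing.scale/= mulr1.
exact: is_derive1_comp (is_derive_ramp _) lin.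
Qed.

Lemma continuous_shat n : continuous (shat n).
Proof.
move=> x; apply: cvgM; last exact: cvg_cst.
apply: cvg_comp; last exact: continuous_hat.
by apply: cvgM; [exact: cvg_cst|exact: cvg_id].
Qed.

Lemma sramp_bounded n x : `|sramp n x| <= 1.
Proof. by have /andP[? ?] := ramp_itv (n.+1%:R * x); rewrite ger0_norm. Qed.

Lemma shat_ge0 n x : 0 <= shat n x.
Proof. by rewrite mulr_ge0//; have /andP[] := hat_itv (n.+1%:R * x). Qed.

Lemma shat_bounded n x : `|shat n x| <= 2 * n.+1%:R.
Proof.
rewrite ger0_norm ?shat_ge0// ler_wpM2r//.
by have /andP[] := hat_itv (n.+1%:R * x).
Qed.

Lemma cvg_sramp x : sramp n x @[n --> \oo] --> (\1_(`]0, +oo[ : set R) x : R).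
Proof.
rewrite indicE; case: (leP x 0) => x0.
  rewrite memNset; last first.
    by rewrite /= in_itv/= andbT; apply/negP; rewrite -leNgt.
  apply: cvg_near_cst; near=> n; apply: ramp_le0.
  by rewrite mulr_ge0_le0.
rewrite mem_set; last by rewrite /= in_itv/= andbT.
apply: cvg_near_cst; near=> n; apply: ramp_ge1.
rewrite -ler_pdivrMr// div1r; apply: ltW.
have : x^-1 <= n%:R by near: n; exact: nbhs_infty_ger.
by move=> /le_lt_trans; apply; rewrite ltr_nat.
Unshelve. all: by end_near. Qed.

Lemma continuous_itv_integrable (f : R -> R) (a b : R) : continuous f ->
  leb.-integrable `[a, b] (EFin \o f).
Proof.
move=> cf; apply: continuous_compact_integrable; first exact: segment_compact.
exact: continuous_subspaceT.
Qed.

Lemma Rintegral_shat n : \int[leb]_(x in `[0, n.+1%:R^-1]) shat n x = 1.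
Proof.
rewrite /Rintegral (@continuous_FTC2 _ _ (sramp n))//.
- by rewrite /sramp mulfV// mulr0 ramp_ge1// ramp_le0//= subr0.
- exact/continuous_subspaceT/continuous_shat.
- have cr : continuous (sramp n) := is_derive_continuous (is_derive_sramp n).
  split; first by move=> x _; case: (is_derive_sramp n x).
    exact/cvg_at_right_filter/cr.
  exact/cvg_at_left_filter/cr.
- by move=> x _; exact: is_derive_derive1 (is_derive_sramp n x).
Qed.

(** The functions shat n are nonnegative, have mass 1 and vanish outside
[0, 1 / n.+1], so integrating F against them averages values of F near 0. *)
Lemma cvg_Rintegral_shat (F : R -> R) : continuous F ->
  \int[leb]_x (shat n x * F x) @[n --> \oo] --> F 0.
Proof.
move=> cF; apply/cvgrPdist_le => /= eps eps0.
have /cvgrPdist_le/(_ _ eps0)/nbhs_ballP[del /= del0 Fdel] := cF 0.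
near=> n; set a : R := n.+1%:R^-1.
have a_del : a < del.
  rewrite /a invf_plt ?posrE//; have : del^-1 <= n%:R.
    by near: n; exact: nbhs_infty_ger.
  by move=> /le_lt_trans; apply; rewrite ltr_nat.
have -> : \int[leb]_x (shat n x * F x) =
    \int[leb]_(x in `[0, a]) (shat n x * F x).
  rewrite [RHS]Rintegral_mkcond; apply: eq_Rintegral => x _.
  rewrite patchE; case: ifPn => //; rewrite notin_setE/= => /negP x0a.
  rewrite /shat hat_out ?mul0r//; move: x0a; apply: contra.
  rewrite !in_itv/= pmulr_rge0// => /andP[-> /=].
  by rewrite -ler_pdivlMl// mulr1.
have iF (G : R -> R) : continuous G ->
    leb.-integrable `[0, a] (EFin \o (fun x => shat n x * G x)).
  move=> cG; apply: continuous_itv_integrable => x.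
  by apply: cvgM; [exact: continuous_shat|exact: cG].
have mass c : \int[leb]_(x in `[0, a]) (shat n x * c) = c.
  rewrite RintegralZr ?Rintegral_shat ?mul1r//.
  exact/continuous_itv_integrable/continuous_shat.
have Fa x : `[0, a]%classic x -> `|F 0 - F x| <= eps.
  rewrite /= in_itv/= => /andP[x0 xa]; apply: Fdel.
  by rewrite /ball/= sub0r normrN ger0_norm// (le_lt_trans xa).
rewrite distrC ler_distl -[X in X <= _ <= _]mass -[X in _ <= _ <= X]mass.
apply/andP; split; apply: le_Rintegral => //.
- by apply: iF => x; exact: cvg_cst.
- exact: iF.
- move=> x /Fa; rewrite distrC ler_distl => /andP[+ _]; apply: ler_wpM2l.
  exact: shat_ge0.
- exact: iF.
- by apply: iF => x; exact: cvg_cst.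
- move=> x /Fa; rewrite distrC ler_distl => /andP[_ +]; apply: ler_wpM2l.
  exact: shat_ge0.
Unshelve. all: by end_near. Qed.

End ShrinkingRamp.

(** * The coefficients of the indicator *)

Section Limits.
Variables (R : realType) (mu : R) (alpha : nat -> R) (e : nat -> R -> R).
Hypothesis he : eigensystem mu alpha e.
Implicit Types j k : nat.

Lemma continuous_w1 : continuous (@w1 R).
Proof. by rewrite -normal_pdf01E; exact/continuous_normal_pdf/oner_neq0. Qed.

Lemma Rintegral_gamma (f : R -> R) : measurable_fun setT f ->
  \int[gamma]_x f x = \int[@lebesgue_measure R]_x (f x * w1 x).
Proof.
move=> mf; apply: Rintegral_density => //.
- exact: (continuous_measurable_fun continuous_w1).
- by move=> x; rewrite mulr_ge0 ?invr_ge0 ?sqrtr_ge0 ?expR_ge0.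
- by move=> A _; exact: gammaE.
Qed.

Lemma cvg_Rintegral_shat_wronskian j k :
  \int[gamma]_x (shat n x * wronskian e j k x) @[n --> \oo] -->
  wronskian e j k 0 * w1 0.
Proof.
have cW : continuous (wronskian e j k).
  move=> x; apply: cvgB; apply: cvgM;
  by [exact: (eigen_derive_continuous he)|exact: (eigen_continuous he)].
rewrite (_ : (fun n => _) = (fun n => \int[@lebesgue_measure R]_x
    (shat n x * (wronskian e j k x * w1 x)))); last first.
  apply/funext => n; rewrite Rintegral_gamma.
    by apply: eq_Rintegral => x _; rewrite mulrA.
  apply: continuous_measurable_fun => x.
  by apply: cvgM; [exact: continuous_shat|exact: cW].
apply: (@cvg_Rintegral_shat _ (fun x => wronskian e j k x * w1 x)) => x.
by apply: cvgM; [exact: cW|exact: continuous_w1].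
Qed.

(** The functions sramp n take values in [0, 1], so |e_k e_j| dominates; it is
integrable as a product of two square-integrable functions. *)
Lemma cvg_Rintegral_sramp j k :
  \int[gamma]_x (e k x * e j x * sramp n x) @[n --> \oo] -->
  \int[gamma]_x (e k x * e j x * \1_(`]0, +oo[ : set R) x).
Proof.
have iee := Lfun2_mul_integrable (eigen_Lfun2 he k) (eigen_Lfun2 he j).
have mee : measurable_fun setT (fun x => e k x * e j x).
  by move/integrableP : iee => [/measurable_EFinP].
have mr n : measurable_fun setT (@sramp R n).
  exact: (continuous_measurable_fun (is_derive_continuous (is_derive_sramp n))).
have := @dominated_convergence _ _ R (@gamma R) setT measurableT
  (fun n x => (e k x * e j x * sramp n x)%:E)
  (fun x => (e k x * e j x * \1_(`]0, +oo[ : set R) x)%:E)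
  (fun x => `|(e k x * e j x)%:E|%E).
case.
- by move=> n; apply/measurable_EFinP; exact: (measurable_funM mee (mr n)).
- by apply/measurable_EFinP; exact: measurable_funM.
- apply: aeW => x _; apply: cvg_EFin; first by near=> n.
  by apply: cvgM; [exact: cvg_cst|exact: cvg_sramp].
- exact: integrable_abse.
- apply: aeW => x n _; rewrite lee_fin normrM ler_piMr//; exact: sramp_bounded.
move=> ilim _; rewrite -(fineK (integrable_fin_num measurableT ilim)).
exact: fine_cvg.
Unshelve. all: by end_near. Qed.

Lemma gap_half_line_integral j k :
  (alpha k - alpha j) *
    \int[gamma]_x (e k x * e j x * \1_(`]0, +oo[ : set R) x) =
  wronskian e j k 0 * w1 0.
Proof.
have green n : \int[gamma]_x (shat n x * wronskian e j k x) =
    (alpha k - alpha j) * \int[gamma]_x (e k x * e j x * sramp n x).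
  (* A common bound for sramp n and shat n. *)
  have le1 : 1 <= 2 * n.+1%:R :> R by rewrite -natrM ler1n.
  apply: (green_identity he (@is_derive_sramp R n) (@continuous_shat R n) _
    (@shat_bounded R n)) => x.
  exact: le_trans (sramp_bounded n x) le1.
have rhs : (alpha k - alpha j) * \int[gamma]_x (e k x * e j x * sramp n x)
    @[n --> \oo] --> (alpha k - alpha j) *
      \int[gamma]_x (e k x * e j x * \1_(`]0, +oo[ : set R) x).
  by apply: cvgM; [exact: cvg_cst|exact: cvg_Rintegral_sramp].
rewrite -(cvg_lim (@Rhausdorff R) rhs); apply: (cvg_lim (@Rhausdorff R)).
rewrite -(eq_cvg _ _ green); exact: cvg_Rintegral_shat_wronskian.
Qed.

(** The density e_0^2 of nu absorbs the denominator of e_k / e_0 and leaves one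
factor e_0. *)
Lemma inner_nu_rquot k (A : set (measurableTypeR R)) : measurable A ->
  inner (nu he) (cfun_of (\1_A)) (cfun_of (rquot e k)) =
  (\int[gamma]_x (e k x * e 0%N x * \1_A x))%:C.
Proof.
move=> mA; rewrite inner_cfun_of; congr (_%:C).
have me i : measurable_fun [set: measurableTypeR R] (e i).
  exact: (continuous_measurable_fun (@eigen_continuous _ _ _ _ he i)).
have e0 x : e 0%N x != 0 by rewrite gt_eqF// (ground_state_gt0 he).
have mr : measurable_fun [set: measurableTypeR R] (rquot e k).
  apply: continuous_measurable_fun => x.
  by apply: cvgM; [|apply: cvgV => //]; exact: (eigen_continuous he).
rewrite (@Rintegral_density _ _ R _ (@gamma R) (fun x => e 0%N x ^+ 2))//.
- by apply: eq_Rintegral => x _; rewrite /rquot; field; exact: e0.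
- exact: measurable_funX.
- by move=> x; exact: sqr_ge0.
- exact: measurable_funM.
Qed.

End Limits.

Theorem mainTheorem9 (R : realType) (mu : R) (mu_gt0 : 0 < mu) (mu_le1 : mu <= 1)
  (alpha : nat -> R) (e : nat -> R -> R) (he : eigensystem mu alpha e) :
  let f : R -> R[i] := cfun_of \1_(`]0, +oo[ : set R) in
  let p : R := fine (nu he `]0, +oo[) in
  let fcoef (k : nat) : R[i] := inner (nu he) f (cfun_of (rquot e k)) in
  fcoef 0%N = p%:C /\
  forall k : nat, (1 <= k)%N ->
    fcoef k = (w1 0 / gap alpha k *
               (e 0%N 0 * derive1 (e k) 0 - derive1 (e 0%N) 0 * e k 0))%:C.
Proof.
move=> f p fcoef; split=> [|k k1].
  rewrite /fcoef inner_nu_rquot//; congr (_%:C); rewrite /p /nu.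
  rewrite -[fine _]/(\int[gamma]_(x in `]0, +oo[) (e 0%N x ^+ 2)).
  rewrite [RHS]Rintegral_mkcond.
  apply: eq_Rintegral => x _; rewrite patchE indicE.
  by case: ifP; rewrite ?mulr1 ?mulr0.
have gap_gt0 : 0 < gap alpha k.
  case: k k1 => // k _; rewrite subr_gt0.
  elim: k => [|k ih]; first exact: (alpha_increasing he).
  exact: lt_trans ih (alpha_increasing he _).
rewrite /fcoef inner_nu_rquot//; congr (_%:C).
apply: (mulfI (lt0r_neq0 gap_gt0)).
rewrite (gap_half_line_integral he 0 k) /wronskian.
by field; exact: lt0r_neq0.
Qed.
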